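(* For all integers $n$ and $k$ with $1\le k\le n+1$, $$\sum_{i=k-1}^n(-1)^{n+i}\frac{i!\,(i+1)!\,s(n,i)}{(i-k+1)!} =\int_0^\infty\frac{\Gamma(u+n)}{\Gamma(u)} \Biggl[\sum_{\ell=0}^{k-1}(-1)^\ell c_{k,\ell}\,u^{k-\ell}\Biggr]e^{-u}\,\mathrm{d}u,$$ where $\Gamma$ is the Euler gamma function and $$c_{k,\ell}=\binom{k}{\ell}\binom{k-1}{\ell}\,\ell!\qquad\text{for } 0\le\ell\le k-1.$$
   Context: The (signed) Stirling numbers of the first kind $s(n,k)$ are defined by $\prod_{k=0}^{n-1}(x-k)=\sum_{k=0}^n s(n,k)x^k$, or equivalently by $\frac{[\ln(1+x)]^m}{m!}=\sum_{k=m}^\infty\frac{s(k,m)}{k!}x^k$ for $|x|<1$. The gamma function is $\Gamma(z)=\int_0^\infty t^{z-1}e^{-t}\,\mathrm{d}t$ for $\Re z>0$. *)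

(* Defs.v *)
From HB Require Import structures.
From mathcomp Require Import all_boot all_order all_algebra.
From mathcomp Require Import all_classical all_reals all_analysis.
Set Implicit Arguments.
Unset Strict Implicit.
Unset Printing Implicit Defensive.
Import Order.TTheory GRing.Theory Num.Theory.
Import numFieldNormedType.Exports.
Local Open Scope classical_set_scope.
Local Open Scope ring_scope.

(* Signed Stirling numbers of the first kind, as the coefficients of the
   falling factorial polynomial X (X - 1) ... (X - (n - 1)). *)
Definition stirling1 (n k : nat) : int :=
  (\prod_(j < n) ('X - (j%:Z)%:P) : {poly int})`_k.

(* The Euler gamma function restricted to the real line.  The integral
   converges only for 0 < z; the values at z <= 0 are meaningless. *)
Definition Gamma (R : realType) (z : R) : R :=
  \int[lebesgue_measure]_(t in `]0, +oo[) (t `^ (z - 1) * expR (- t)).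

Definition c_coef (k l : nat) : nat := ('C(k, l) * 'C(k.-1, l) * l`!)%N.

(* Main.v *)
(* Since Gamma (z + 1) = z Gamma z, the quotient Gamma (u + n) / Gamma u is the
   rising factorial u (u + 1) ... (u + n - 1), whose coefficients are the
   (-1)^(n + i) s(n, i).  Integrating monomial by monomial against exp (- u)
   replaces u^(i + k - l) by (i + k - l)!, and the remaining sum over l equals
   k! i! sum_l (-1)^l C(k-1, l) C(i + k - l, i), a (k-1)-st finite difference of
   a binomial coefficient, that is k! i! C(i + 1, k); this vanishes for i < k - 1
   and is i! (i + 1)! / (i + 1 - k)! otherwise. *)
Require Import Defs.
From HB Require Import structures.
From mathcomp Require Import all_boot all_order all_algebra.
From mathcomp Require Import all_classical all_reals all_analysis.
From mathcomp Require Import measurable_realfun ring lra.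
Import Order.TTheory GRing.Theory Num.Theory.
Import numFieldNormedType.Exports.
Local Open Scope classical_set_scope.
Local Open Scope ring_scope.

(** * Finite differences of binomial coefficients *)

(** Pascal's rule on ['C(m.+1, l)] splits a difference of order [m.+1] into two of order [m], based
    at [a.+1] and [a]. *)
Lemma sum_sign_binS (A : comPzRingType) (f : nat -> A) (m a : nat) :
  \sum_(l < m.+2) (-1) ^+ l * 'C(m.+1, l)%:R * f (a + (m.+1 - l))%N =
  \sum_(l < m.+1) (-1) ^+ l * 'C(m, l)%:R * f (a.+1 + (m - l))%N
  - \sum_(l < m.+1) (-1) ^+ l * 'C(m, l)%:R * f (a + (m - l))%N.
Proof.
rewrite big_ord_recl (eq_bigr (fun l : 'I_m.+1 =>
    (-1) ^+ l.+1 * 'C(m, l.+1)%:R * f (a + (m - l))%N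
    - (-1) ^+ l * 'C(m, l)%:R * f (a + (m - l))%N)); last first.
  by move=> l _; rewrite lift0 subSS binS natrD exprS; ring.
rewrite sumrB addrA; congr (_ - _).
rewrite [RHS]big_ord_recl big_ord_recr /= [in X in _ + (_ + X)]bin_small //.
rewrite mulr0 mul0r addr0 !bin0 !subn0 addSnnS; congr (_ + _).
apply: eq_bigr => l _; rewrite /bump leq0n add1n.
by congr (_ * f _); rewrite addSnnS subnSK.
Qed.

(** Each difference lowers the bottom index by one; once it is 0, the next difference vanishes. *)
Lemma sum_sign_bin_bin (A : comPzRingType) (m i a : nat) :
  \sum_(l < m.+1) (-1) ^+ l * 'C(m, l)%:R * 'C(a + (m - l), i)%:R =
  (if (m <= i)%N then 'C(a, i - m)%:R else 0) :> A.
Proof.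
elim: m a => [|m IH] a.
  by rewrite big_ord_recl big_ord0 /= addr0 !mul1r addn0 subn0.
rewrite (@sum_sign_binS A (fun b => 'C(b, i)%:R)) !IH.
case: (ltngtP m i) => [lt_mi|lt_im|->]; last by rewrite subnn !bin0 subrr.
  by rewrite -(subnSK lt_mi) binS natrD addrC addKr.
by rewrite subrr.
Qed.

Lemma sum_c_coef (A : comPzRingType) (i k : nat) : (0 < k)%N ->
  \sum_(l < k) (-1) ^+ l * (c_coef k l)%:R * ((i + (k - l))`!)%:R =
  (k`! * i`! * 'C(i.+1, k))%:R :> A.
Proof.
case: k => // m _.
(* C(m+1, l) l! (m+1-l)! recombines into (m+1)!, and what remains is a term of a difference of order
   [m] based at [i.+1]. *)
have cE (l : 'I_m.+1) : (c_coef m.+1 l * (i + (m.+1 - l))`! =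
    m.+1`! * i`! * ('C(m, l) * 'C(i.+1 + (m - l), i)))%N.
  have lem : (l <= m)%N by rewrite -ltnS.
  have H1 := bin_fact (leqW lem).
  have le2 : (i <= i.+1 + (m - l))%N by rewrite addSn leqW// leq_addr.
  have H2 := bin_fact le2.
  rewrite /c_coef /=.
  have -> : (i + (m.+1 - l) = i.+1 + (m - l))%N by rewrite subSn// addSnnS.
  rewrite -H1 -H2.
  have -> : (i.+1 + (m - l) - i = m.+1 - l)%N by rewrite subSn// addSnnS addKn.
  ring.
under eq_bigr => l _ do
  rewrite -mulrA -natrM cE natrM [X in _ * (_ * X)]natrM mulrCA
    (mulrA ((-1) ^+ l)).
rewrite -mulr_sumr sum_sign_bin_bin [RHS]natrM; congr (_ * _).
(* Symmetry turns C(i+1, i-m) into C(i+1, m+1); for i < m both sides are 0. *)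
case: (leqP m i) => mi; last by rewrite bin_small.
by rewrite -bin_sub ?leq_subr ?(leq_trans (leq_subr _ _))// subSn ?leq_subr//
  subKn.
Qed.

(** * Rising factorials and Stirling numbers *)

(** The rising factorial at u is (-1)^n times the falling factorial at -u. *)
Lemma prod_rising_stirling1 (A : comNzRingType) (n : nat) (u : A) :
  \prod_(j < n) (u + j%:R) =
  \sum_(i < n.+1) (-1) ^+ (n + i) * (stirling1 n i)%:~R * u ^+ i.
Proof.
pose p : {poly int} := \prod_(j < n) ('X - (j%:Z)%:P).
have szp : size p = n.+1.
  by rewrite size_prod_XsubC /index_enum -enumT size_enum_ord.
have -> : \prod_(j < n) (u + j%:R) = (-1) ^+ n * (map_poly intr p).[- u].
  rewrite rmorph_prod horner_prod -[n in (-1) ^+ n]card_ord -prodr_const -big_split.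
  apply: eq_bigr => j _ /=.
  by rewrite map_polyXsubC hornerXsubC mulN1r opprB opprK addrC.
rewrite (@horner_coef_wide _ n.+1); last by rewrite -szp size_poly.
rewrite mulr_sumr; apply: eq_bigr => i _.
by rewrite coef_map /= (exprNn u) exprD -/(stirling1 n i); ring.
Qed.

(** * The gamma integral in the extended reals *)

Section Gamma_integral.
Context {R : realType}.
Implicit Types z a b c t : R.
Local Notation mu := (@lebesgue_measure R).

Definition gamma_fun z t := t `^ (z - 1) * expR (- t).

(* Working in the extended reals yields the functional equation before
   convergence is known, and convergence is then deduced from it. *)
Definition eGamma z : \bar R := (\int[mu]_(t in `]0%R, +oo[) (gamma_fun z t)%:E)%E.

Lemma Gamma_eGamma z : Gamma z = fine (eGamma z).
Proof. by []. Qed.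

Lemma gamma_fun_ge0 z t : 0 <= gamma_fun z t.
Proof. by rewrite mulr_ge0 ?powR_ge0 ?expR_ge0. Qed.

Lemma measurable_gamma_fun z (D : set R) :
  measurable_fun D (EFin \o gamma_fun z).
Proof.
apply: measurable_funTS; apply/measurable_EFinP; apply: measurable_funM.
  exact: measurable_powR.
by apply: measurableT_comp => //; exact: measurableT_comp.
Qed.

Lemma eGamma_ge0 z : (0 <= eGamma z)%E.
Proof. by apply: integral_ge0 => t _; rewrite lee_fin gamma_fun_ge0. Qed.

(* Makes the integral comparable with its values at integers, hence both finite
   and positive. *)
Lemma powR_le_add t a b c : 0 < t -> a <= b -> b <= c ->
  t `^ b <= t `^ a + t `^ c.
Proof.
move=> t0 ab bc; have [t1|t1] := leP t 1.
  by rewrite ler_wpDr ?powR_ge0// ger_powR ?t0.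
by rewrite ler_wpDl ?powR_ge0// ler_powR// ltW.
Qed.

Lemma eGamma_le_add a b c : a <= b -> b <= c ->
  (eGamma b <= eGamma a + eGamma c)%E.
Proof.
move=> ab bc; rewrite /eGamma -ge0_integralD//; last 4 first.
- by move=> t _; rewrite lee_fin gamma_fun_ge0.
- exact: measurable_gamma_fun.
- by move=> t _; rewrite lee_fin gamma_fun_ge0.
- exact: measurable_gamma_fun.
apply: ge0_le_integral => //.
- by move=> t _; rewrite lee_fin gamma_fun_ge0.
- exact: measurable_gamma_fun.
- by apply: emeasurable_funD; exact: measurable_gamma_fun.
move=> t /=; rewrite in_itv/= andbT => t0.
rewrite -EFinD lee_fin /gamma_fun -mulrDl ler_wpM2r ?expR_ge0//.
by rewrite powR_le_add// lerD2r.
Qed.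

(** * Integration by parts and the functional equation *)

Lemma is_derive_expRN t : is_derive t 1 (fun x : R => expR (- x)) (- expR (- t)).
Proof. by apply: is_derive_eq; rewrite mulrN1. Qed.

(** Supplies the endpoint continuity that [integration_by_parts] requires. *)
Lemma derivable_oo_LRcontinuous_itv (f : R -> R) a b :
  {in `[a, b], forall x, derivable f x 1} -> a < b ->
  derivable_oo_LRcontinuous f a b.
Proof.
move=> df ab.
have cf x : x \in `[a, b] -> {for x, continuous f}.
  by move=> /df dfx; apply/differentiable_continuous/derivable1_diffP.
split.
- by move=> x /subset_itv_oo_cc; exact: df.
- by apply/cvg_at_right_filter/cf; rewrite in_itv/= lexx ltW.
- by apply/cvg_at_left_filter/cf; rewrite in_itv/= lexx ltW.
Qed.

(** Integration by parts of t^z against the derivative of exp (- t), away from 0, where t^z may fail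
    to be differentiable. *)
Lemma integral_gamma_funS z a b : 0 < a -> a < b ->
  (\int[mu]_(t in `[a, b]) (gamma_fun (z + 1) t)%:E =
   (a `^ z * expR (- a) - b `^ z * expR (- b))%:E
   + z%:E * \int[mu]_(t in `[a, b]) (gamma_fun z t)%:E)%E.
Proof.
move=> a0 ab.
have t_gt0 t : t \in `[a, b] -> 0 < t.
  by rewrite in_itv/= => /andP[+ _]; exact: lt_le_trans.
have dpow p : {in `[a, b], forall x, derivable (@powR R ^~ p) x 1}.
  by move=> t /t_gt0 t0; apply: derivable_powR; rewrite in_itv/= t0.
have dexp : {in `[a, b], forall x, derivable (fun x : R => expR (- x)) x 1}.
  by move=> t _; have [] := is_derive_expRN t.
have := @integration_by_parts R (@powR R ^~ z) (fun t => expR (- t))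
  (fun t => z * t `^ (z - 1)) (fun t => - expR (- t)) a b ab.
have EL : (\int[mu]_(t in `[a, b]) (t `^ z * - expR (- t))%:E =
    - \int[mu]_(t in `[a, b]) (gamma_fun (z + 1) t)%:E)%E.
  rewrite -integral_ge0N; last by move=> t _; rewrite lee_fin gamma_fun_ge0.
  by apply: eq_integral => t _; rewrite /gamma_fun addrK mulrN.
have ER : (\int[mu]_(t in `[a, b]) (z * t `^ (z - 1) * expR (- t))%:E =
    z%:E * \int[mu]_(t in `[a, b]) (gamma_fun z t)%:E)%E.
  rewrite -integralZl//; last first.
    apply: continuous_compact_integrable; first exact: segment_compact.
    apply: derivable_within_continuous => t tab.
    by apply: derivableM; [exact: dpow|exact: dexp].
  by apply: eq_integral => t _; rewrite /gamma_fun -EFinM mulrA.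
rewrite EL ER => ibp; rewrite -[LHS]oppeK ibp//.
- by rewrite oppeB ?fin_num_adde_defr// -EFinN opprB.
- apply: derivable_within_continuous => t tab.
  by apply: derivableM => //; exact: dpow.
- exact: derivable_oo_LRcontinuous_itv.
- move=> t /subset_itv_oo_cc /t_gt0 t0.
  by rewrite powR_derive1// in_itv/= t0.
- by apply: derivable_within_continuous => t tab; apply: derivableN; exact: dexp.
- exact: derivable_oo_LRcontinuous_itv.
- by move=> t _; rewrite derive1E; exact: (@derive_val _ _ _ _ _ _ _ (is_derive_expRN t)).
Qed.


(** Monotone convergence along the intervals [1/(m+1), m+2]. The bound m+2 keeps them nondegenerate
    at m = 0, as integration by parts needs. *)
Lemma cvg_integral_gamma_fun z :
  (\int[mu]_(t in `[@harmonic R m, m.+2%:R]) (gamma_fun z t)%:E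
    @[m --> \oo] --> eGamma z)%E.
Proof.
pose D (m : nat) : set R := `[@harmonic R m, m.+2%:R]%classic.
have -> : eGamma z = (\int[mu]_(t in \bigcup_m D m) (gamma_fun z t)%:E)%E.
  congr (integral _ _ _); apply/seteqP; split => t /=.
    rewrite in_itv/= andbT => t0.
    have t10 : 0 < t^-1 by rewrite invr_gt0.
    (* Any m above t + 1/t puts t in the m-th interval. *)
    have := archi_boundP (addr_ge0 (ltW t0) (ltW t10)).
    move: (Num.bound _) => m tm; exists m => //; rewrite /D/= in_itv/= -[t in leRHS]invrK.
    rewrite lef_pV2 ?posrE ?ltr0n//.
    by rewrite -!natr1; lra.
  move=> [m _]; rewrite /D/= !in_itv/= andbT => /andP[mt _].
  by apply: lt_le_trans mt; rewrite invr_gt0 ltr0n.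
apply: (@ge0_nondecreasing_set_cvg_integral _ (measurableTypeR R) R D (EFin \o gamma_fun z) mu).
- apply/nondecreasing_seqP => m; apply/subsetPset => t.
  rewrite /D/= !in_itv/= => /andP[mt tm]; rewrite (le_trans tm) ?ler_nat// andbT.
  by apply: le_trans mt; rewrite lef_pV2 ?posrE ?ltr0n// ler_nat.
- by move=> m; exact: measurable_itv.
- by move=> m; exact: measurable_gamma_fun.
- by move=> m t _; rewrite lee_fin gamma_fun_ge0.
Qed.

Lemma cvg_powR_expR_harmonic z : 0 < z ->
  @harmonic R m `^ z * expR (- @harmonic R m) @[m --> \oo] --> 0.
Proof.
move=> z0.
have h0 : @harmonic R m `^ z @[m --> \oo] --> 0.
  have /cvg_at_rightP := powR_cvg0 z0; apply.
  by split; [move=> m; exact: harmonic_gt0|exact: cvg_harmonic].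
apply: squeeze_cvgr (cvg_cst 0) h0; near=> m.
by rewrite mulr_ge0 ?powR_ge0 ?expR_ge0//= ler_piMr ?powR_ge0//.
Unshelve. end_near. Qed.

(** With N > z and x = m+2, the bound exp x >= x^(N+1)/(N+1)! gives x^z exp (- x) <= (N+1)!/x. *)
Lemma cvg_powR_expR_nat z : 0 < z ->
  m.+2%:R `^ z * expR (- m.+2%:R) @[m --> \oo] --> (0 : R).
Proof.
move=> z0; set N := Num.bound z.
have h0 : N.+1`!%:R * @harmonic R m @[m --> \oo] --> 0.
  by rewrite -(mulr0 N.+1`!%:R); apply: cvgMr; exact: cvg_harmonic.
apply: squeeze_cvgr (cvg_cst 0) h0; near=> m.
rewrite mulr_ge0 ?powR_ge0 ?expR_ge0//=.
have b0 : 0 < m.+2%:R :> R by rewrite ltr0n.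
have f0 : 0 < N.+1`!%:R :> R by rewrite ltr0n fact_gt0.
have zN : m.+2%:R `^ z <= m.+2%:R ^+ N :> R.
  by rewrite -powR_mulrn ?ler_powR ?ler1n ?ltW// archi_boundP// ltW.
have expN : m.+2%:R ^+ N * m.+2%:R <= N.+1`!%:R * expR m.+2%:R :> R.
  rewrite -exprSr mulrC -ler_pdivrMr// (le_trans _ (expR_ge1Dxn N (ltW b0)))//.
  by rewrite lerDr.
apply: (@le_trans _ _ (N.+1`!%:R / m.+2%:R)).
  rewrite expRN ler_pdivrMr ?expR_gt0// mulrAC ler_pdivlMr//.
  by apply: le_trans expN; rewrite ler_wpM2r// ltW.
by rewrite ler_wpM2l ?(ltW f0)//= lef_pV2 ?posrE// ler_nat.
Unshelve. end_near. Qed.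

Lemma eGammaS z : 0 < z -> eGamma (z + 1) = (z%:E * eGamma z)%E.
Proof.
move=> z0; apply: cvg_unique (cvg_integral_gamma_fun (z + 1)) _ => //.
rewrite -[(_ * _)%E]add0e.
rewrite (_ : (fun m => _) = (fun m : nat =>
    (@harmonic R m `^ z * expR (- @harmonic R m) -
     m.+2%:R `^ z * expR (- m.+2%:R))%:E +
    z%:E * \int[mu]_(t in `[@harmonic R m, m.+2%:R]) (gamma_fun z t)%:E)%E); last first.
  apply/funext => m; apply: integral_gamma_funS; first exact: harmonic_gt0.
  by rewrite (@le_lt_trans _ _ 1) ?ltr1n// invf_le1 ?ltr0n// ler1n.
(* The boundary terms have the finite limit 0, so the sum of limits is defined even if [eGamma z] is
   infinite. *)
apply: cvgeD => //; last by apply: cvgeZl => //; exact: cvg_integral_gamma_fun.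
apply: cvg_EFin; first exact: nearW.
rewrite -[0](subr0 0); apply: cvgB.
- exact: cvg_powR_expR_harmonic.
- exact: cvg_powR_expR_nat.
Qed.

(** The integrand is the exponential density of rate 1, of total mass 1; the endpoint 0 is
    negligible. *)
Lemma eGamma1 : eGamma 1 = 1%E.
Proof.
rewrite -(@integral_exponential_pdf R 1 ltr01) /eGamma integral_itv_obnd_cbnd; last first.
  exact: measurable_gamma_fun.
rewrite integral_mkcond; apply: eq_integral => t _.
rewrite /exponential_pdf !patchE; case: ifP => // _.
by rewrite /gamma_fun subrr powRr0 !mul1r mulN1r.
Qed.

Lemma eGamma_nat n : eGamma n.+1%:R = (n`!%:R)%:E.
Proof.
elim: n => [|n IH]; first exact: eGamma1.
by rewrite -[n.+2]addn1 natrD eGammaS ?ltr0n// IH -EFinM -natrM factS.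
Qed.

(** * Finiteness and positivity *)

(** Since z may be below 1, it is z + 1 that is bracketed between the integers 1 and N + 1; the
    functional equation then descends to z. *)
Lemma eGamma_fin_num z : 0 < z -> eGamma z \is a fin_num.
Proof.
move=> z0; have : (eGamma (z + 1) < +oo)%E.
  have zN := archi_boundP (ltW z0); set N := Num.bound z in zN.
  have z1 : 1 <= z + 1 by rewrite lerDr ltW.
  have zN1 : z + 1 <= N.+1%:R by rewrite -natr1 lerD2r ltW.
  apply: le_lt_trans (eGamma_le_add _ _ _ z1 zN1) _.
  by rewrite eGamma1 eGamma_nat -EFinD ltry.
rewrite eGammaS// => h; rewrite ge0_fin_numE ?eGamma_ge0//.
by case: (eGamma z) (eGamma_ge0 z) h => // [r|] _; rewrite ?ltry// gt0_muley// lte_fin.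
Qed.

Lemma Gamma_gt0 z : 0 < z -> 0 < Gamma z.
Proof.
move=> z0; rewrite Gamma_eGamma fine_gt0// ltey_eq eGamma_fin_num// andbT.
(* A zero at z would propagate to z + N + 1, and N + 1 lies between these two points, so N! would be
   at most 0. *)
rewrite lt_neqAle eGamma_ge0 andbT; apply/eqP => /esym Gz0.
have Gzn n : eGamma (z + n%:R) = 0%E.
  elim: n => [|n IH]; first by rewrite addr0.
  by rewrite -natr1 addrA eGammaS ?IH ?mule0// ltr_wpDr.
have zN := archi_boundP (ltW z0); set N := Num.bound z in zN.
have zN1 : z <= N.+1%:R by rewrite (le_trans (ltW zN))// ler_nat.
have := @eGamma_le_add z N.+1%:R (z + N.+1%:R) zN1.
rewrite lerDr ltW// => /(_ isT).
by rewrite Gz0 Gzn eGamma_nat adde0 lee_fin lern0 eqn0Ngt fact_gt0.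
Qed.

Lemma GammaS z : 0 < z -> Gamma (z + 1) = z * Gamma z.
Proof.
by move=> z0; rewrite !Gamma_eGamma eGammaS// fineM// eGamma_fin_num.
Qed.

Lemma Gamma_add_nat z n : 0 < z ->
  Gamma (z + n%:R) / Gamma z = \prod_(j < n) (z + j%:R).
Proof.
move=> z0; elim: n => [|n IH].
  by rewrite addr0 big_ord0 divff// gt_eqF// Gamma_gt0.
by rewrite big_ord_recr/= -IH -natr1 addrA GammaS ?ltr_wpDr// -mulrA mulrC.
Qed.

(** * Termwise integration and the final identity *)

(** u^d exp (- u) is the integrand of Gamma at d + 1. The coefficients may have any sign, so
    linearity goes through integrability. *)
Lemma integral_sum_exprn_expR (I : Type) (s : seq I) (a : I -> R) (d : I -> nat) :
  (\int[mu]_(u in `]0%R, +oo[)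
     ((\sum_(i <- s) a i * u ^+ d i) * expR (- u))%:E =
   (\sum_(i <- s) a i * (d i)`!%:R)%:E)%E.
Proof.
have intg i : mu.-integrable `]0%R, +oo[ (EFin \o gamma_fun (d i).+1%:R).
  apply/integrableP; split; first exact: measurable_gamma_fun.
  under eq_integral do rewrite gee0_abs ?lee_fin ?gamma_fun_ge0//.
  by rewrite -/(eGamma _) eGamma_nat ltry.
transitivity (\int[mu]_(u in `]0%R, +oo[)
    \sum_(i <- s) (a i)%:E * (gamma_fun (d i).+1%:R u)%:E)%E.
  apply: eq_integral => u; rewrite inE/= in_itv/= andbT => u0.
  rewrite mulr_suml -sumEFin; apply: eq_bigr => i _.
  by rewrite /gamma_fun -natr1 addrK powR_mulrn ?ltW// -EFinM mulrA.
rewrite integral_sum//; last by move=> i; apply: integrableZl => //; exact: intg.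
rewrite -sumEFin; apply: eq_bigr => i _.
by rewrite integralZl//; [rewrite -/(eGamma _) eGamma_nat -EFinM|exact: intg].
Qed.

End Gamma_integral.

Theorem theorem4p1 (R : realType) (n k : nat) (hk : (1 <= k <= n + 1)%N) :
  (\sum_(k.-1 <= i < n.+1)
       (-1) ^+ (n + i)
       * ((i`!)%:R * ((i + 1)`!)%:R * (stirling1 n i)%:~R
          / ((i + 1 - k)`!)%:R) : R)%:E
  = (\int[lebesgue_measure]_(u in `]0%R, +oo[)
     (Gamma (u + n%:R) / Gamma u
      * (\sum_(0 <= l < k) (-1) ^+ l * (c_coef k l)%:R * u ^+ (k - l))
      * expR (- u))%:E)%E.
Proof.
have [k_gt0 k_le] := andP hk.
(* Multiplying out the two sums gives one sum of monomials indexed by pairs (i, l). *)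
pose a (p : 'I_n.+1 * 'I_k) : R := (-1) ^+ (n + p.1) * (stirling1 n p.1)%:~R *
  ((-1) ^+ p.2 * (c_coef k p.2)%:R).
pose d (p : 'I_n.+1 * 'I_k) := (p.1 + (k - p.2))%N.
transitivity (\int[lebesgue_measure]_(u in `]0%R, +oo[)
    ((\sum_(p <- index_enum _) a p * u ^+ d p) * expR (- u))%:E)%E; last first.
  apply: eq_integral => u; rewrite inE/= in_itv/= andbT => u0.
  rewrite Gamma_add_nat// prod_rising_stirling1; congr ((_ * _)%:E).
  rewrite big_mkord big_distrlr pair_bigA; apply: eq_bigr => -[i l] _ /=.
  by rewrite /a /d /= (exprD u); ring.
rewrite integral_sum_exprn_expR; congr (_%:E).
rewrite -(pair_bigA _ (fun i l => a (i, l) * (d (i, l))`!%:R)) /=.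
pose F (i : nat) : R := (-1) ^+ (n + i) * (stirling1 n i)%:~R *
  (k`! * i`! * 'C(i.+1, k))%:R.
transitivity (\sum_(0 <= i < n.+1) F i); last first.
  rewrite big_mkord; apply: eq_bigr => i _; rewrite /F -(@sum_c_coef R)// mulr_sumr.
  by apply: eq_bigr => l _; rewrite /a /d /= !mulrA.
(* The terms with i < k - 1 vanish because C(i+1, k) = 0 there. *)
rewrite [RHS](@big_cat_nat _ _ _ k.-1)//=; last by rewrite (leq_trans (leq_pred k))// -addn1.
rewrite [X in X + _]big_nat [X in X + _]big1 ?add0r => [|i /andP[_ ik]]; last first.
  by rewrite /F bin_small ?muln0 ?mulr0// -(prednK k_gt0).
rewrite !big_nat; apply: eq_bigr => i /andP[ki _].
have ki1 : (k <= i.+1)%N by rewrite -(prednK k_gt0).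
(* As k <= i + 1, the truncated difference is exact and (i+1)! = C(i+1, k) k! (i+1-k)!. *)
rewrite /F addn1 -(bin_fact ki1) !natrM.
have : ((i.+1 - k)`!)%:R != 0 :> R by rewrite pnatr_eq0 -lt0n fact_gt0.
by move=> f0; field.
Qed.
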